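(* The following decision problem can be solved in linear time: given $n$ teams with strengths $s_i\in\mathbb{N}$, decide whether there exists a fair draw in which every team plays $k=2$ matches.
   Context: A draw (for $k$ matches per team, $1\le k\le n-1$) on a set $T$ of $n$ teams is a set of $nk/2$ matches, i.e. unordered pairs of distinct teams, such that each team occurs in exactly $k$ matches. The opponent set of a team is the set of the $k$ teams it plays against. The strength of an opponent set is the average strength of its teams. A draw is fair if the strengths of all $n$ opponent sets are equal. *)

(* Defs.v *)
From mathcomp Require Import all_boot all_order all_algebra.

Set Implicit Arguments.
Unset Strict Implicit.
Unset Printing Implicit Defensive.

Import GRing.Theory.

Section Draws.

Variable T : finType.

Definition is_draw (k : nat) (D : {set {set T}}) : Prop :=
  [/\ forall m, m \in D -> #|m| = 2,
      #|D| * 2 = #|T| * k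
    & forall t : T, #|[set m in D | t \in m]| = k].

Definition opponents (D : {set {set T}}) (t : T) : {set T} :=
  [set u | (u != t) && ([set t; u] \in D)].

Definition strength (s : T -> nat) (A : {set T}) : rat :=
  ((\sum_(u in A) s u)%N%:R / #|A|%:R)%R.

Definition fair (s : T -> nat) (D : {set {set T}}) : Prop :=
  forall t u : T, strength s (opponents D t) = strength s (opponents D u).

Definition has_fair_draw (k : nat) (s : T -> nat) : Prop :=
  exists D : {set {set T}}, is_draw k D /\ fair s D.

End Draws.

(* Random-access machine with a register file and a word-addressed memory,
   both initially zero outside the input.  A program mentions only finitely
   many registers; memory is reached only through addresses held in
   registers.  Every instruction costs one time unit; the only arithmetic is
   addition and truncated subtraction. *)

Inductive instr : Type :=
| Const (r v : nat)        (* R[r] := v *)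
| Add (r a b : nat)        (* R[r] := R[a] + R[b] *)
| Sub (r a b : nat)        (* R[r] := R[a] - R[b], or 0 if R[a] < R[b] *)
| LoadM (r a : nat)        (* R[r] := M[R[a]] *)
| StoreM (a r : nat)       (* M[R[a]] := R[r] *)
| Jpos (r l : nat)         (* if R[r] > 0 then jump to instruction l *)
| Halt.

Record config : Type :=
  Config { pc : nat; reg : nat -> nat; mem : nat -> nat }.

Definition upd (f : nat -> nat) (a v : nat) : nat -> nat :=
  fun x => if x == a then v else f x.

(* Running off the end of the program, or jumping outside it, halts. *)
Definition current (P : seq instr) (c : config) : instr := nth Halt P (pc c).

Definition halted (P : seq instr) (c : config) : bool :=
  if current P c is Halt then true else false.

Definition step (P : seq instr) (c : config) : config :=
  let: Config i R M := c in
  match current P c with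
  | Const r v => Config i.+1 (upd R r v) M
  | Add r a b => Config i.+1 (upd R r (R a + R b)) M
  | Sub r a b => Config i.+1 (upd R r (R a - R b)) M
  | LoadM r a => Config i.+1 (upd R r (M (R a))) M
  | StoreM a r => Config i.+1 R (upd M (R a) (R r))
  | Jpos r l => Config (if 0 < R r then l else i.+1) R M
  | Halt => c
  end.

Definition run (P : seq instr) (t : nat) (c : config) : config :=
  iter t (step P) c.

(* The number of input values is in register 0, the values themselves are in
   memory cells 0, 1, ..., size s - 1. *)
Definition init (s : seq nat) : config :=
  Config 0 (upd (fun _ => 0) 0 (size s)) (nth 0 s).

(* Words have W * log2 (size s + max s + 2) bits: proportional to what is
   needed to hold one input value or one index into the input.  This rules out
   exploiting unit-cost operations on huge integers. *)
Definition word_bound (W : nat) (s : seq nat) : nat :=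
  (size s + \max_(x <- s) x + 2) ^ W.

Definition fits (b : nat) (c : config) : Prop :=
  forall x, reg c x < b /\ mem c x < b.

(* The promise problem with instance set [dom] and yes-instances [L] is solved
   in time linear in the number of input values; the answer (1 for yes, 0 for
   no) is left in register 0. *)
Definition linear_time_decidable (dom L : seq nat -> Prop) : Prop :=
  exists (P : seq instr) (C W : nat), forall s : seq nat, dom s ->
    exists t : nat,
      [/\ t <= C * (size s).+1,
          halted P (run P t (init s)),
          forall t', t' <= t -> fits (word_bound W s) (run P t' (init s)),
          L s -> reg (run P t (init s)) 0 = 1
        & ~ L s -> reg (run P t (init s)) 0 = 0].

(* Main.v *)
Require Import Defs.
From mathcomp Require Import all_boot all_order all_algebra.
From mathcomp Require Import zify.

Set Implicit Arguments.
Unset Strict Implicit.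
Unset Printing Implicit Defensive.

(** A draw with k = 2 is a 2-regular graph, that is a union of cycles of length
    at least 3, and it is fair iff for some c the neighbours of each team have
    strengths of sum c.  Along a cycle, teams at distance 2 then have strengths
    of sum c, so the multiset of strengths is symmetric about c/2, and each
    cycle either consists of teams of strength c/2 or can be split into 4-cycles
    a, b, c-a, c-b.  Hence a fair draw exists iff the multiset is symmetric and
    the numbers p of teams below c/2 and h of teams at c/2 satisfy: h is not 1
    or 2 if p is even, and h is 2 or at least 5 if p is odd.  A random-access
    machine checks this in linear time, without sorting, by using the memory as
    a table of occurrence counts indexed by the strengths. *)

(** * Opponent sets as neighbourhoods in a graph *)

Lemma opponents_sym (T : finType) (D : {set {set T}}) (t u : T) :
  (u \in opponents D t) = (t \in opponents D u).
Proof. by rewrite !inE eq_sym setUC. Qed.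

(** [u |-> [set t; u]] maps the opponents of [t] bijectively to the matches of [t]. *)
Lemma card_opponents (T : finType) k (D : {set {set T}}) (t : T) :
  is_draw k D -> #|opponents D t| = k.
Proof.
move=> [D2 _ /(_ t) <-]; rewrite -(card_in_imset (f := fun u => [set t; u])).
  congr #|pred_of_set _|; apply/setP=> m; apply/imsetP/idP.
    by move=> [u]; rewrite !inE => /andP[_ tuD] ->; rewrite tuD set21.
  rewrite inE => /andP[mD tm].
  have /eqP/cards2P[x [y [xy mE]]] := D2 _ mD.
  move: tm; rewrite mE => /set2P[tE|tE]; subst t.
    by exists y; rewrite // !inE eq_sym xy -mE mD.
  by exists x; rewrite 1?setUC // !inE xy setUC -mE mD.
move=> u v /[!inE] /andP[ut _] /andP[vt _] E.
by have := set22 t u; rewrite E => /set2P[/eqP|//]; rewrite (negPf ut).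
Qed.

Lemma cardsI_sum (T : finType) (A B : {set T}) :
  #|A :&: B| = \sum_(u in B) (u \in A).
Proof.
rewrite -sum1_card big_mkcond [RHS]big_mkcond /=.
by apply: eq_bigr => u _; rewrite inE; case: (u \in B); case: (_ \in _).
Qed.

(** * Counting in two-regular graphs *)

Section TwoRegular.

Variables (T : finType) (N : T -> {set T}).
Hypothesis N_sym : forall t u, (u \in N t) = (t \in N u).

Lemma sum_neighbours (A B : {set T}) :
  \sum_(t in A) #|N t :&: B| = \sum_(u in B) #|N u :&: A|.
Proof.
under eq_bigr do rewrite cardsI_sum.
rewrite exchange_big /=; apply: eq_bigr => u _; rewrite cardsI_sum.
by apply: eq_bigr => t _; rewrite N_sym.
Qed.

Hypothesis N_irr : forall t, t \notin N t.

(** Each edge inside [A] is counted once from its end of lower rank and once from its end of higher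
    rank. *)
Lemma handshake (A : {set T}) : ~~ odd (\sum_(t in A) #|N t :&: A|).
Proof.
pose r (t : T) : nat := enum_rank t.
have E (t : T) : #|N t :&: A| =
    \sum_(u in A | r t < r u) (u \in N t) + \sum_(u in A | r u < r t) (u \in N t).
  rewrite cardsI_sum (bigID (fun u => r t < r u)) /=; congr (_ + _).
  rewrite big_mkcondr [RHS]big_mkcondr; apply: eq_bigr => u _.
  by have [||/ord_inj/enum_rank_inj <-] := ltngtP; rewrite ?(negPf (N_irr t)).
under eq_bigr do rewrite E.
rewrite big_split /=.
have -> : \sum_(t in A) \sum_(u in A | r u < r t) (u \in N t) =
          \sum_(t in A) \sum_(u in A | r t < r u) (u \in N t).
  rewrite (exchange_big_dep (mem A)) /=; last by move=> ? ? _ /andP[].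
  by apply: eq_bigr => u uA; apply: eq_big => [t|t _]; rewrite ?uA // N_sym.
by rewrite addnn odd_double.
Qed.

Variables (s : T -> nat) (c : nat).
Hypothesis N_pair : forall t, exists x y,
  [/\ x != y, N t = [set x; y] & s x + s y = c].

Let cardN t : #|N t| = 2.
Proof. by have [x [y [xy -> _]]] := N_pair t; rewrite cards2 xy. Qed.

(** Each team has as many neighbours of strength [v] as of strength [c - v]; the sum over all teams
    counts every such neighbour twice. *)
Lemma mirror_card v : v <= c ->
  #|[set t | s t == v]| = #|[set t | s t == c - v]|.
Proof.
move=> vc; have E (B : {set T}) : \sum_(t in [set: T]) #|N t :&: B| = #|B| * 2.
  rewrite sum_neighbours (eq_bigr (fun=> 2)) ?sum_nat_const //.
  by move=> u _; rewrite setIT cardN.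
suff : #|[set t | s t == v]| * 2 = #|[set t | s t == c - v]| * 2 by lia.
rewrite -!E; apply: eq_bigr => t _.
have [x [y [xy -> xyc]]] := N_pair t.
by rewrite ![[set x; y] :&: _]setIC !cardsI_sum !big_setU1 ?inE //= !big_set1 !inE; lia.
Qed.

(* The neighbours of a team are both half-valued, or one is low and one is high.
   Let [A] be the teams of the first kind; with [H] and [L] the half-valued and
   low teams, take [a = #|L :&: A|], [b = #|L :\: A|] and [h' = #|H :&: A|].
   Low teams outside [A] are perfectly matched among themselves, and [H :&: A]
   contains the closed neighbourhood of each of its members. *)
Lemma half_low_card :
  let h := #|[set t | s t + s t == c]| in
  let p := #|[set t | s t + s t < c]| in
  exists a b h', [/\ h = h' + 2 * a, p = a + b, ~~ odd b & h' = 0 \/ 2 < h'].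
Proof.
move=> h p; pose H := [set t | s t + s t == c]; pose L := [set t | s t + s t < c].
pose A := [set t | N t \subset H].
have LH t : t \in L -> t \notin H by rewrite !inE; lia.
have NH t u : u \in N t -> (u \in H) = (t \in A).
  have [x [y [xy Nt xyc]]] := N_pair t.
  rewrite [t \in A]inE Nt subUset !sub1set !inE.
  by case/orP=> /eqP ->; lia.
have NL t : #|N t :&: L| = (t \notin A).
  have [x [y [xy Nt xyc]]] := N_pair t.
  have xN : x \in N t by rewrite Nt set21.
  have yN : y \in N t by rewrite Nt set22.
  have := NH _ _ xN; have := NH _ _ yN.
  case: (t \in A) => xH yH /=.
    apply: eq_card0 => u; rewrite inE Nt !inE; apply/negP => /andP[].
    by move: xH yH; rewrite !inE => xH yH /orP[]/eqP->; lia.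
  have [w wE] : exists w, N t :&: L = [set w].
    case: (boolP (x \in L)) => xL; [exists x | exists y];
      apply/setP => u; rewrite !inE Nt !inE; move: xH yH xL; rewrite !inE => xH yH xL;
      apply/idP/idP => [/andP[/orP[]/eqP-> //]|/eqP->]; rewrite ?eqxx ?orbT //; lia.
  by rewrite wE cards1.
exists #|L :&: A|, #|L :\: A|, #|H :&: A|; split.
(* Double count the edges between [H :\: A] and [L]: a team of [H :\: A] has one low neighbour; a
   low team has both neighbours in [H :\: A] if it is in [A], and none otherwise. *)
- rewrite /h -/H -(cardsID A H); congr (_ + _).
  transitivity (\sum_(t in H :\: A) #|N t :&: L|).
    rewrite -sum1_card; apply: eq_bigr => t; rewrite inE => /andP[tA _].
    by rewrite NL tA.
  rewrite sum_neighbours (big_setID A) /=.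
  rewrite [X in _ + X]big1 ?addn0 => [|u]; last first.
    rewrite inE => /andP[uA uL]; apply: eq_card0 => t.
    rewrite in_setI in_setD; apply/negP => /and3P[tu _ tH].
    by rewrite -(NH _ _ tu) tH in uA.
  rewrite mulnC -sum_nat_const; apply: eq_bigr => u.
  rewrite inE => /andP[uL uA]; rewrite -(cardN u); congr #|pred_of_set _|.
  apply/setIidPl/subsetP => t tu; rewrite inE (NH _ _ tu) uA andbT.
  by rewrite -(NH t u) ?LH // N_sym.
- by rewrite /p -/L -(cardsID A L).
- rewrite -sum1_card (eq_bigr (fun t => #|N t :&: (L :\: A)|)) ?handshake //.
  move=> t; rewrite inE => /andP[tA tL].
  have := NL t; rewrite tA /= => <-; congr #|pred_of_set _|.
  apply/setP => u; rewrite !in_setI in_setD; case: (boolP (u \in N t)) => //= ut.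
  by rewrite -(NH u t) ?(LH t tL) // -N_sym.
- have [->|[t /setIP[tH tA]]] := set_0Vmem (H :&: A); first by left; rewrite cards0.
  right; rewrite -(cardN t) -[#|N t|]/(0 + #|N t|).
  have <- : #|t |: N t| = (#|N t|).+1 by rewrite cardsU1 N_irr.
  apply/subset_leq_card/subsetP => u /setU1P[->|ut]; first by rewrite inE tH.
  by rewrite inE (NH _ _ ut) tA -(NH u t) // -N_sym.
Qed.

End TwoRegular.

(** Take the matches [[set x; f x]]: the opponents of [f w] are [w] and [f (f w)], which are
    distinct and have strengths of sum [c]. *)
Lemma draw_of_injection (T : finType) (s : T -> nat) (c : nat) (f : T -> T) :
  injective f -> (forall x, f (f x) != x) ->
  (forall x, s x + s (f (f x)) = c) -> has_fair_draw 2 s.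
Proof.
move=> f_inj ffx sff; have fx x : f x != x.
  by apply: contraNneq (ffx x) => E; rewrite !E.
pose m x := [set x; f x].
have m_inj : injective m.
  move=> x y mxy; have := set21 x (f x); have := set22 x (f x).
  rewrite -/(m x) mxy => /set2P[fxy|/f_inj //] /set2P[//|xfy].
  by have := ffx x; rewrite fxy -xfy eqxx.
exists [set m x | x : T]; set D := [set m x | x : T].
have mD x : m x \in D by apply: imset_f.
have opp t : exists2 w, f w = t & opponents D t = [set f t; w].
  have [g _ fK] := injF_bij f_inj; exists (g t) => //.
  apply/setP=> u; rewrite !inE; apply/andP/orP.
    move=> [ut /imsetP[x _ mx]].
    have := set21 t u; have := set22 t u; rewrite mx => /set2P[] uE /set2P[] tE.
    - by rewrite uE tE eqxx in ut.
    - by right; apply/eqP/f_inj; rewrite uE fK.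
    - by left; rewrite uE tE.
    - by rewrite uE tE eqxx in ut.
  case=> /eqP ->; first by split; [|exact: mD].
  split; first by rewrite -{2}(fK t) eq_sym.
  by rewrite setUC -{2}(fK t); apply: mD.
split; last first.
  move=> t u; have [w <- ->] := opp t; have [w' <- ->] := opp u.
  by rewrite /strength !big_setU1 ?inE //= !big_set1 !cards2 !ffx ![s (f _) + _]addnC !sff.
split=> [_ /imsetP[x _ ->]||t].
- by rewrite cards2 eq_sym fx.
- by rewrite card_imset.
- have [w wt _] := opp t.
  suff -> : [set x in D | t \in x] = [set m t; m w].
    by rewrite cards2 (inj_eq m_inj) -wt fx.
  apply/setP=> x; rewrite !inE; apply/andP/orP.
    move=> [/imsetP[y _ ->] /set2P[->|tf]]; first by left.
    by right; apply/eqP; congr m; apply: f_inj; rewrite wt.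
  by case=> /eqP ->; rewrite mD /m ?set21 -?wt ?set22.
Qed.

(** * The numerical criterion and its necessity *)

(* In a fair draw the strength multiset is symmetric, so the common sum of the
   two opponents' strengths is the minimum plus the maximum; this avoids a
   division on the machine. *)
Definition center (s : seq nat) : nat :=
  \big[minn/nth 0 s 0]_(x <- s) x + \max_(x <- s) x.

(* With [p] teams below and [h] teams at half the center, the disjunction says
   that [h] is neither 1 nor 2 for even [p], and that [h] is 2 or at least 5 for
   odd [p]; the offset 3 protects [h - 2] from truncation. *)
Definition fair_test (s : seq nat) : bool :=
  let c := center s in
  let z := count (fun v => v + v == c) s + 3 -
           (odd (count (fun v => v + v < c) s)).*2 in
  all (fun v => count_mem v s <= count_mem (c - v) s) s && ((z == 3) || (5 < z)).

Lemma bigminn_le (x0 x : nat) (r : seq nat) :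
  x \in r -> \big[minn/x0]_(y <- r) y <= x.
Proof.
elim: r => // y r IHr; rewrite inE big_cons geq_min => /orP[/eqP->|/IHr->].
  by rewrite leqnn.
by rewrite orbT.
Qed.

Lemma bigminn_mem (x0 : nat) (r : seq nat) :
  \big[minn/x0]_(y <- r) y \in x0 :: r.
Proof.
elim: r => [|y r]; first by rewrite big_nil mem_head.
rewrite big_cons minnE !inE; set m := \big[minn/x0]_(y <- r) y.
have [ym|ym] := leqP y m; first by rewrite (eqP ym) subn0 eqxx orbT.
by rewrite subKn 1?ltnW // => /orP[->|->]; rewrite ?orbT.
Qed.

Lemma bigmaxn_mem (r : seq nat) : r != [::] -> \max_(y <- r) y \in r.
Proof.
elim: r => // y [|z r] IHr _; first by rewrite big_seq1 mem_head.
rewrite big_cons; set m := \max_(_ <- _) _; rewrite inE.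
by case: (leqP y m) => _; rewrite ?eqxx // IHr ?orbT.
Qed.

Lemma count_ord (s : seq nat) (P : pred nat) :
  count P s = #|[set i : 'I_(size s) | P (nth 0 s i)]|.
Proof.
rewrite -sum1_count (big_nth 0) big_mkord -sum1_card.
by apply: eq_bigl => i; rewrite inE.
Qed.

(** The reflection [v |-> c - v] exchanges minimum and maximum. *)
Lemma center_eq (s : seq nat) (c : nat) :
  s != [::] -> (forall v, v \in s -> v <= c) ->
  (forall v, v \in s -> c - v \in s) -> center s = c.
Proof.
move=> s0 le_c mem_c; have Ms := bigmaxn_mem s0.
have ms : \big[minn/nth 0 s 0]_(x <- s) x \in s.
  have := bigminn_mem (nth 0 s 0) s; rewrite inE => /orP[/eqP->|//].
  by rewrite mem_nth // lt0n size_eq0.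
have lo := bigminn_le (nth 0 s 0) (mem_c _ Ms).
have hi := @leq_bigmax_seq _ s xpredT id _ (mem_c _ ms) isT.
rewrite /center; move: lo hi (le_c _ Ms) (le_c _ ms).
by set lo := \big[minn/_]_(_ <- _) _; set hi := \max_(_ <- _) _; lia.
Qed.

Lemma has_fair_draw_test (s : seq nat) :
  2 < size s -> has_fair_draw 2 (fun i : 'I_(size s) => nth 0 s i) -> fair_test s.
Proof.
set f := fun i : 'I_(size s) => nth 0 s i => n2 [D [D2 fairD]].
have cardN t : #|opponents D t| = 2 by apply: card_opponents D2.
pose i0 : 'I_(size s) := Ordinal (ltn_trans (isT : 0 < 2) n2).
pose c := \sum_(u in opponents D i0) f u.
have Nsum t : \sum_(u in opponents D t) f u = c.
  have two : ((2%:R : rat)^-1 != 0)%R by [].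
  have := fairD t i0; rewrite /strength !cardN => /(GRing.mulIf two)/eqP.
  by rewrite Num.Theory.eqr_nat => /eqP.
have N_irr t : t \notin opponents D t by rewrite inE eqxx.
have N_pair t : exists x y,
    [/\ x != y, opponents D t = [set x; y] & f x + f y = c].
  have /eqP/cards2P[x [y [xy Nxy]]] := cardN t.
  by exists x, y; split=> //; rewrite -(Nsum t) Nxy big_setU1 ?inE //= big_set1.
have f_le i : f i <= c.
  have [x [y [_ Nxy _]]] := N_pair i.
  by rewrite -(Nsum x) (bigD1 i) ?leq_addr //= opponents_sym Nxy set21.
have le_c v : v \in s -> v <= c.
  by move=> /(nthP 0)[i i_s <-]; apply: (f_le (Ordinal i_s)).
have mirror v : v \in s -> count_mem v s = count_mem (c - v) s.
  move=> vs; rewrite !count_ord.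
  exact: (mirror_card (@opponents_sym _ D) N_pair (le_c _ vs)).
have cE : center s = c.
  apply: center_eq => // [|v vs]; first by rewrite -size_eq0 -lt0n (ltn_trans _ n2).
  by rewrite -has_pred1 has_count -mirror // -has_count has_pred1.
have [a [b [h [hE pE b_even h_val]]]] :=
  half_low_card (@opponents_sym _ D) N_irr N_pair.
rewrite /fair_test cE; apply/andP; split.
  by apply/allP => v /mirror ->.
(* As [b] is even, [a] has the parity of the low count. For [h = 0] the tested value is 3 if
   [a <= 1] and at least 7 otherwise; for [2 < h] it is at least 6. *)
rewrite !count_ord hE pE; lia.
Qed.

(** * Sufficiency: cycles on the sorted strengths *)

Section Pairing.

Variables n q : nat.
Hypotheses (q_even : ~~ odd q) (q_half : q.*2 <= n).
Hypothesis middle : n - q.*2 = 0 \/ 2 < n - q.*2.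

(* Positions in the sorted list of strengths, where [i] and [n - 1 - i] have sum
   [center]: the outer positions form the 4-cycles
   [i -> i+1 -> n-1-i -> n-2-i -> i] for even [i < q], and the positions in
   [q, n - q) form one cycle. *)
Definition next_team (i : nat) : nat :=
  if i < q then (if odd i then n - i else i.+1)
  else if n - q <= i then (if odd (n - 1 - i) then n - 2 - i else i.-1)
  else if i.+1 == n - q then q else i.+1.

Lemma next_team_ltn i : i < n -> next_team i < n.
Proof. by rewrite /next_team; do !case: ifPn; lia. Qed.

Lemma next_team_inj i j :
  i < n -> j < n -> next_team i = next_team j -> i = j.
Proof. by rewrite /next_team; do !case: ifPn; lia. Qed.

Lemma next_team2_outer i :
  i < n -> (i < q) || (n - q <= i) -> next_team (next_team i) = n - 1 - i.
Proof. by rewrite /next_team; do !case: ifPn; lia. Qed.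

Lemma next_team2_inner i : q <= i < n - q -> q <= next_team (next_team i) < n - q.
Proof. by rewrite /next_team; do !case: ifPn; lia. Qed.

Lemma next_team2_neq i : i < n -> next_team (next_team i) != i.
Proof. by rewrite /next_team; do !case: ifPn; lia. Qed.

End Pairing.

Lemma count_trichotomy (c : nat) (s : seq nat) :
  size s = count (fun v => v + v < c) s + count (fun v => v + v == c) s +
           count (fun v => c < v + v) s.
Proof. elim: s => //= v s ->; lia. Qed.

(** If entry [i] were low, so would be the first [i.+1] entries, which exceeds the low count. *)
Lemma sorted_nth_count (t : seq nat) (c i : nat) :
  sorted leq t -> count (fun v => v + v < c) t <= i < size t ->
  c <= nth 0 t i + nth 0 t i.
Proof.
move=> t_sorted /andP[p_i i_t]; rewrite leqNgt; apply/negP => lo_i.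
have : all (fun v => v + v < c) (take i.+1 t).
  apply/(all_nthP 0) => j; rewrite size_take => j_i.
  rewrite nth_take; last by move: j_i; case: ifP; lia.
  have : nth 0 t j <= nth 0 t i.
    apply: (sorted_leq_nth leq_trans leqnn) => //; rewrite ?inE //;
      by move: j_i; case: ifP; lia.
  lia.
rewrite all_count size_take => /eqP cnt.
have := count_cat (fun v => v + v < c) (take i.+1 t) (drop i.+1 t).
by rewrite cat_take_drop cnt; case: ifP; lia.
Qed.

Lemma fair_test_has_draw (s : seq nat) :
  2 < size s -> fair_test s -> has_fair_draw 2 (fun i : 'I_(size s) => nth 0 s i).
Proof.
rewrite /fair_test; set c := center s; set n := size s.
move=> n2 /andP[/allP mir szs].
have le_c v : v \in s -> v <= c.
  move=> vs; apply: leq_trans (leq_addl _ _).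
  exact: (@leq_bigmax_seq _ s xpredT id _ vs isT).
have mem_c v : v \in s -> c - v \in s.
  move=> vs; rewrite -has_pred1 has_count; apply: leq_trans (mir v vs).
  by rewrite -has_count has_pred1.
have eq_c v : v \in s -> count_mem v s = count_mem (c - v) s.
  move=> vs; apply/eqP; rewrite eqn_leq mir //=.
  by have := mir _ (mem_c v vs); rewrite subKn ?le_c.
have s_perm : perm_eq s (map (subn c) s).
  apply/allP => x; rewrite mem_cat => xs.
  have {}xs : x \in s by case/orP: xs => // /mapP[y ys ->]; apply: mem_c.
  apply/eqP; rewrite /= count_map (eq_c _ xs); apply: eq_in_count => y ys /=.
  by have := le_c _ xs; have := le_c _ ys; lia.
set h := count _ s in szs; set p := count _ s in szs.
have nE : n = p.*2 + h.
  rewrite /n (count_trichotomy c s) -/p -/h.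
  have -> : count (fun v => c < v + v) s = p.
    rewrite (permP s_perm) count_map; apply: eq_in_count => v /le_c /=; lia.
  lia.
pose t := sort leq s.
have t_sorted : sorted leq t by apply: sort_sorted leq_total _.
have ts : perm_eq t s by rewrite perm_sort.
have t_size : size t = n by rewrite size_sort.
(* The reversed reflection is a sorted permutation of [s], hence equals [t]. *)
have tE : t = rev (map (subn c) t).
  apply: (sorted_eq leq_trans anti_leq) => //.
    rewrite rev_sorted sorted_map; apply: sub_sorted t_sorted => x y /=; lia.
  rewrite perm_sym perm_rev perm_sym (perm_trans ts) // (perm_trans s_perm) //.
  by rewrite perm_sym perm_map.
have t_pair i : i < n -> nth 0 t i + nth 0 t (n - 1 - i) = c.
  move=> i_n; have i_n' : n - 1 - i < n by lia.
  have : nth 0 t (n - 1 - i) \in s by rewrite -(perm_mem ts) mem_nth ?t_size.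
  move/le_c; rewrite {2}tE nth_rev size_map t_size // (nth_map 0) ?t_size; last lia.
  have -> : n - i.+1 = n - 1 - i by lia.
  lia.
(* For odd [p], the outer 4-cycles absorb one pair of half-valued teams. *)
pose q := p + odd p.
have q_even : ~~ odd q by rewrite /q; lia.
have q_half : q.*2 <= n by rewrite /q; lia.
have middle : n - q.*2 = 0 \/ 2 < n - q.*2 by rewrite /q; lia.
(* Position [i] and its mirror both lie past the low entries, so neither strength is below half of
   their sum [c]. *)
have t_half i : q <= i < n - q -> nth 0 t i + nth 0 t i = c.
  move=> qi; have pE : count (fun v => v + v < c) t = p by apply: permP ts _.
  have pi : p <= i < n by rewrite /q in qi; lia.
  have pi' : p <= n - 1 - i < n by rewrite /q in qi; lia.
  have := @sorted_nth_count t c i t_sorted.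
  have := @sorted_nth_count t c (n - 1 - i) t_sorted.
  rewrite pE t_size => /(_ pi') + /(_ pi).
  have := t_pair i; lia.
have t_next i : i < n -> nth 0 t i + nth 0 t (next_team n q (next_team n q i)) = c.
  move=> i_n; case: (boolP (q <= i < n - q)) => qi.
    by have := t_half _ qi; have := t_half _ (next_team2_inner q_even q_half middle qi); lia.
  by rewrite next_team2_outer ?t_pair //; lia.
(* [Is] lists the teams in sorted order; its inverse [k] transports [next_team] from positions to
   teams. *)
have [Is IsP tIs] := perm_iotaP 0 ts.
have Is_size : size Is = n by rewrite (perm_size IsP) size_iota.
have Is_uniq : uniq Is by rewrite (perm_uniq IsP) iota_uniq.
have Is_mem i : (i \in Is) = (i < n) by rewrite (perm_mem IsP) mem_iota.
pose k (i : 'I_n) := index (i : nat) Is.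
have k_n i : k i < n by rewrite -Is_size index_mem Is_mem.
have f_n i : nth 0 Is (next_team n q (k i)) < n.
  by rewrite -Is_mem mem_nth ?Is_size ?next_team_ltn.
pose f i : 'I_n := Ordinal (f_n i).
have kf i : k (f i) = next_team n q (k i).
  by rewrite /k index_uniq ?Is_size ?next_team_ltn.
have k_inj : injective k.
  move=> i j kij; apply: val_inj => /=.
  by rewrite -(nth_index 0 (s := Is) (x := i)) ?Is_mem // -/(k i) kij nth_index ?Is_mem.
have sk (i : 'I_n) : nth 0 s i = nth 0 t (k i).
  by rewrite tIs (nth_map 0) ?Is_size // nth_index ?Is_mem.
apply: (@draw_of_injection _ _ c f) => [i j ij|i|i].
- by apply/k_inj/(next_team_inj q_even q_half middle); rewrite // -!kf ij.
- by rewrite -(inj_eq k_inj) !kf next_team2_neq.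
- by rewrite !sk !kf t_next.
Qed.

(** * Timed execution within a word bound *)

(* ssreflect's [Sub] would otherwise shadow the instruction. *)
Import Defs.

Definition eventually (P : seq instr) (b k : nat) (Q : config -> Prop)
    (c : config) : Prop :=
  exists t, [/\ t <= k, Q (run P t c) & forall t', t' <= t -> fits b (run P t' c)].

Section Machine.

Variables (P : seq instr) (b : nat).

Lemma eventually_now k Q c : fits b c -> Q c -> eventually P b k Q c.
Proof. by move=> cb Qc; exists 0; split=> // -[]. Qed.

Lemma eventually_step k Q c :
  fits b c -> eventually P b k Q (step P c) -> eventually P b k.+1 Q c.
Proof.
move=> cb [t [tk Qt tb]]; exists t.+1; split=> //; first by rewrite /run iterSr.
by case=> [|t'] // t'k; rewrite /run iterSr; apply: tb.
Qed.

Lemma eventually_trans k1 k2 Q1 Q2 c :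
  eventually P b k1 Q1 c ->
  (forall c', fits b c' -> Q1 c' -> eventually P b k2 Q2 c') ->
  eventually P b (k1 + k2) Q2 c.
Proof.
move=> [t1 [t1k Q1c b1]] /(_ _ (b1 _ (leqnn _)) Q1c) [t2 [t2k Q2c b2]].
exists (t2 + t1); split; first lia.
  by rewrite /run iterD.
move=> t t12; case: (leqP t t1) => [|/ltnW tt1]; first exact: b1.
by rewrite -(subnK tt1) /run iterD; apply: b2; lia.
Qed.

Lemma eventually_loop k (I : nat -> config -> Prop) n c :
  (forall i c', fits b c' -> I i.+1 c' -> eventually P b k (I i) c') ->
  fits b c -> I n c -> eventually P b (k * n) (I 0) c.
Proof.
move=> body; elim: n c => [|n IHn] c cb Ic; first exact: eventually_now.
by rewrite mulnS; apply: eventually_trans (body _ _ cb Ic) _ => c' *; apply: IHn.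
Qed.

Variables (k i : nat) (Q : config -> Prop) (R M : nat -> nat).
Hypothesis RMb : fits b (Config i R M).

Let fits_upd_reg r v : v < b -> fits b (Config i.+1 (upd R r v) M).
Proof.
by move=> vb x; case: (RMb x) => /= Rx Mx; split; rewrite //= /upd; case: ifP.
Qed.

(** Only [Const] and [Add] can exceed the values already stored, so only their rules ask for a
    bound. *)
Lemma eventually_Const r v :
  nth Halt P i = Const r v -> v < b ->
  (fits b (Config i.+1 (upd R r v) M) ->
   eventually P b k Q (Config i.+1 (upd R r v) M)) ->
  eventually P b k.+1 Q (Config i R M).
Proof.
move=> Pi vb C; apply: eventually_step => //.
by rewrite /step /current Pi; apply: C; apply: fits_upd_reg.
Qed.

Lemma eventually_Add r x y :
  nth Halt P i = Add r x y -> R x + R y < b ->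
  (fits b (Config i.+1 (upd R r (R x + R y)) M) ->
   eventually P b k Q (Config i.+1 (upd R r (R x + R y)) M)) ->
  eventually P b k.+1 Q (Config i R M).
Proof.
move=> Pi vb C; apply: eventually_step => //.
by rewrite /step /current Pi; apply: C; apply: fits_upd_reg.
Qed.

Lemma eventually_Sub r x y :
  nth Halt P i = Sub r x y ->
  (fits b (Config i.+1 (upd R r (R x - R y)) M) ->
   eventually P b k Q (Config i.+1 (upd R r (R x - R y)) M)) ->
  eventually P b k.+1 Q (Config i R M).
Proof.
move=> Pi C; apply: eventually_step => //.
rewrite /step /current Pi; apply: C; apply: fits_upd_reg.
by apply: leq_ltn_trans (leq_subr _ _) _; case: (RMb x).
Qed.

Lemma eventually_LoadM r x :
  nth Halt P i = LoadM r x ->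
  (fits b (Config i.+1 (upd R r (M (R x))) M) ->
   eventually P b k Q (Config i.+1 (upd R r (M (R x))) M)) ->
  eventually P b k.+1 Q (Config i R M).
Proof.
move=> Pi C; apply: eventually_step => //.
rewrite /step /current Pi; apply: C; apply: fits_upd_reg.
by case: (RMb (R x)).
Qed.

Lemma eventually_StoreM x r :
  nth Halt P i = StoreM x r ->
  (fits b (Config i.+1 R (upd M (R x) (R r))) ->
   eventually P b k Q (Config i.+1 R (upd M (R x) (R r)))) ->
  eventually P b k.+1 Q (Config i R M).
Proof.
move=> Pi C; apply: eventually_step => //.
rewrite /step /current Pi; apply: C => y; case: (RMb y) => /= Ry My.
by split; rewrite //= /upd; case: ifP => // _; case: (RMb r).
Qed.

Lemma eventually_Jpos r l :
  nth Halt P i = Jpos r l ->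
  (fits b (Config (if 0 < R r then l else i.+1) R M) ->
   eventually P b k Q (Config (if 0 < R r then l else i.+1) R M)) ->
  eventually P b k.+1 Q (Config i R M).
Proof.
by move=> Pi C; apply: eventually_step => //; rewrite /step /current Pi; apply: C.
Qed.

End Machine.

Arguments upd : simpl never.

(* [rewrite] with an equation for [upd] is exponential on nested updates. *)
Ltac read_upd :=
  repeat match goal with
  | |- context [upd ?f ?a ?v ?x] =>
    change (upd f a v x) with (if x == a then v else f x); simpl
  end.

Ltac exec :=
  lazymatch goal with
  | |- fits _ (Config ?i _ _) -> eventually ?P _ _ _ _ =>
    let j := eval vm_compute in (nth Halt P i) in
    let cb := fresh in
    intro cb;
    lazymatch j with
    | Const _ _ => refine (eventually_Const (P := P) cb (erefl j) _ _)
    | Add _ _ _ => refine (eventually_Add (P := P) cb (erefl j) _ _)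
    | Sub _ _ _ => refine (eventually_Sub (P := P) cb (erefl j) _)
    | LoadM _ _ => refine (eventually_LoadM (P := P) cb (erefl j) _)
    | StoreM _ _ => refine (eventually_StoreM (P := P) cb (erefl j) _)
    | Jpos _ _ => refine (eventually_Jpos (P := P) cb (erefl j) _)
    end;
    clear cb; read_upd; simpl
  end.

(* Registers: 0 holds n, 1 the constant 1, 2 the loop counter, running downwards,
   3 the current value v.  The loop at 4 updates the maximum (4) and the minimum
   (5) and increments the cell n + v.  The loop at 17, with the center in
   register 4, sums the excesses of the number of occurrences of v over that of
   center - v (8), adds the number of half-valued teams to 3 (9) and toggles the
   parity of the number of low teams (10).  Bits are computed without jumps by
   truncated subtraction, as in [(0 < x) = 1 - (1 - x)]. *)
Definition fair_program : seq instr :=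
  [:: Const 1 1; Add 2 0 3; LoadM 5 3; Const 9 3;
    (* 4 *) Sub 2 2 1; LoadM 3 2;
    Sub 6 3 4; Add 4 4 6; Sub 6 5 3; Sub 5 5 6;
    Add 6 0 3; LoadM 7 6; Add 7 7 1; StoreM 6 7;
    Jpos 2 4;
    (* 15 *) Add 4 4 5; Add 2 0 2;
    (* 17 *) Sub 2 2 1; LoadM 3 2; Sub 5 4 3;
    Add 6 0 3; LoadM 6 6; Add 7 0 5; LoadM 7 7; Sub 6 6 7; Add 8 8 6;
    Sub 6 5 3; Sub 7 3 5; Add 7 6 7; Sub 7 1 7; Add 9 9 7;
    Sub 6 1 6; Sub 6 1 6; Sub 7 6 10; Sub 10 10 6; Add 10 10 7;
    Jpos 2 17;
    (* 37 *) Sub 9 9 10; Sub 9 9 10;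
    Const 2 3; Sub 3 9 2; Sub 4 2 9; Add 3 3 4; Sub 3 1 3;
    Const 2 5; Sub 4 9 2; Add 3 3 4;
    Sub 3 1 3; Sub 0 1 3; Sub 0 0 8; Halt].

(** * Correctness and running time of the program *)

Section Correctness.

Variable s : seq nat.

Let n := size s.
Let K := \max_(x <- s) x.
Let b := word_bound 2 s.
Let c := center s.

Hypothesis n_gt2 : 2 < n.

Let b_large : 5 * (n + K + 2) <= b.
Proof. by rewrite /b /word_bound -/n -/K expnS expn1 leq_mul //; lia. Qed.

(** Register 8 sums at most [n] excesses, each at most [n]. *)
Let b_quad : n * n + n < b.
Proof. by rewrite /b /word_bound -/n -/K expnS expn1; nia. Qed.

Let le_K i : i < n -> nth 0 s i <= K.
Proof.
by move=> i_n; apply: (@leq_bigmax_seq _ s xpredT id); rewrite ?mem_nth.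
Qed.

Let max_drop i : \max_(x <- drop i s) x <= K.
Proof.
rewrite -(big_map id xpredT id) map_id; apply/bigmax_leqP_seq => x /mem_drop xs _.
exact: (@leq_bigmax_seq _ s xpredT id).
Qed.

Let center_le : c <= K.*2.
Proof.
rewrite /c /center -/K -addnn leq_add2r; have := le_K (ltn_trans (isT : 0 < 2) n_gt2).
by apply: leq_trans; apply: bigminn_le; rewrite mem_nth // (ltn_trans _ n_gt2).
Qed.

(** The loop runs downwards, so [drop i s] is the part already processed. *)
Record counting_inv (i : nat) (x : config) : Prop := CountingInv {
  counting_pc : pc x = if 0 < i then 4 else 15;
  counting_le : i <= n;
  counting_r0 : reg x 0 = n;
  counting_r1 : reg x 1 = 1;
  counting_r2 : reg x 2 = i;
  counting_r4 : reg x 4 = \max_(v <- drop i s) v;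
  counting_r5 : reg x 5 = \big[minn/nth 0 s 0]_(v <- drop i s) v;
  counting_r8 : reg x 8 = 0;
  counting_r9 : reg x 9 = 3;
  counting_r10 : reg x 10 = 0;
  counting_mem : forall a,
    mem x a = if a < n then nth 0 s a else count_mem (a - n) (drop i s)
}.

Record testing_inv (i : nat) (x : config) : Prop := TestingInv {
  testing_pc : pc x = if 0 < i then 17 else 37;
  testing_le : i <= n;
  testing_r0 : reg x 0 = n;
  testing_r1 : reg x 1 = 1;
  testing_r2 : reg x 2 = i;
  testing_r4 : reg x 4 = c;
  testing_r8 : reg x 8 =
    \sum_(v <- drop i s) (count_mem v s - count_mem (c - v) s);
  testing_r9 : reg x 9 = count (fun v => v + v == c) (drop i s) + 3;
  testing_r10 : reg x 10 = odd (count (fun v => v + v < c) (drop i s));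
  testing_mem : forall a,
    mem x a = if a < n then nth 0 s a else count_mem (a - n) s
}.

Lemma counting_body i x :
  fits b x -> counting_inv i.+1 x ->
  eventually fair_program b 11 (counting_inv i) x.
Proof.
case: x => l R M + [/= lE i_n r0 r1 r2 r4 r5 r8 r9 r10 rM]; subst l.
have i_n' : (i < n) = true by [].
have ds := drop_nth 0 i_n; rewrite -/n in ds.
have vK := le_K i_n; have mK := max_drop i.+1.
set v := nth 0 s i in ds vK; set m := \max_(_ <- _) _ in r4 mK.
have rv : M i = v by rewrite rM i_n'.
have nv : (n + v < n) = false by lia.
have cnt : count_mem v (drop i.+1 s) <= n.
  by apply: leq_trans (count_size _ _) _; rewrite size_drop leq_subr.
do 4 (exec; rewrite ?r2 ?r1 ?subn1 /= ?rv ?r4); first lia.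
do 3 (exec; rewrite ?r0 ?r5); first lia.
do 2 (exec; rewrite ?rM ?nv ?addKn ?r1); first by move: cnt; set k := count_mem _ _; lia.
do 2 exec; move=> xb.
apply: eventually_now => //; split; rewrite /=; read_upd; rewrite ?ds ?big_cons //=.
- lia.
- rewrite -[X in maxn _ X]/m; lia.
- set m' := \big[minn/_]_(_ <- _) _; lia.
- move=> a; rewrite /upd rM; case: (eqVneq a (n + v)) => [->|].
    by rewrite nv addKn /= eqxx addnC.
  case: ifP => // a_n av /=; suff -> : (v == a - n) = false by [].
  lia.
Qed.

Lemma testing_body i x :
  fits b x -> testing_inv i.+1 x ->
  eventually fair_program b 20 (testing_inv i) x.
Proof.
case: x => l R M + [/= lE i_n r0 r1 r2 r4 r8 r9 r10 rM]; subst l.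
have i_n' : (i < n) = true by [].
have ds := drop_nth 0 i_n; rewrite -/n in ds.
have vK := le_K i_n.
set v := nth 0 s i in ds vK.
have rv : M i = v by rewrite rM i_n'.
have nv w : (n + w < n) = false by lia.
have cnt P r : count P (drop r s) <= n.
  by apply: leq_trans (count_size _ _) _; rewrite size_drop leq_subr.
have v_c : v <= c.
  apply: leq_trans (leq_addl _ _).
  by apply: (@leq_bigmax_seq _ s xpredT id); rewrite ?mem_nth.
have err : \sum_(v <- drop i s) (count_mem v s - count_mem (c - v) s) <= n * n.
  apply: (@leq_trans (\sum_(v <- drop i s) n)).
    apply: leq_sum => w _; apply: leq_trans (leq_subr _ _) _.
    by rewrite -[s]drop0 cnt.
  by rewrite big_const_seq count_predT iter_addn_0 leq_mul // size_drop leq_subr.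
have hb := cnt (fun v => v + v == c) i; rewrite ds /= in hb.
rewrite ds big_cons in err.
do 4 (exec; rewrite ?r2 ?r1 ?subn1 /= ?rv ?r4 ?r0); first lia.
do 2 (exec; rewrite ?r0 ?rM ?nv ?addKn); first lia.
do 3 (exec; rewrite ?r0 ?rM ?nv ?addKn ?r8); first by rewrite addnC; apply: leq_ltn_trans err _; lia.
do 3 exec; first lia.
do 2 (exec; rewrite ?r1 ?r9); first lia.
do 5 (exec; rewrite ?r1 ?r10); first by move: b_large; clear; case: (odd _); lia.
exec; move=> xb.
apply: eventually_now => //; split; rewrite /=; read_upd; rewrite ?ds ?big_cons //=.
- exact: ltnW.
- exact: addnC.
- rewrite addnAC; congr (_ + _); rewrite addnC; congr (_ + _).
  by move: v_c; clear; case: eqP; lia.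
(* The new parity is the distance of two bits, that is their exclusive or. *)
- rewrite oddD; move: v_c; clear; case: (odd _); case: ltnP; rewrite /= => *; lia.
Qed.

Lemma counting_start : eventually fair_program b 4 (counting_inv n) (init s).
Proof.
have : fits b (init s).
  move=> a; rewrite /= /upd; split; first by case: ifP; lia.
  case: (ltnP a n) => [/le_K|a_n]; first lia.
  by rewrite nth_default //; lia.
rewrite /init -/n; do 4 (exec; first try lia).
move=> xb; apply: eventually_now => //.
split; rewrite /=; read_upd; rewrite ?drop_size ?big_nil ?addn0 //.
  by rewrite (ltn_trans _ n_gt2).
by move=> a; case: ltnP => // a_n; rewrite nth_default.
Qed.

Lemma testing_start x :
  fits b x -> counting_inv 0 x -> eventually fair_program b 2 (testing_inv n) x.
Proof.
case: x => l R M + [/= lE _ r0 r1 r2 r4 r5 r8 r9 r10 rM]; subst l.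
rewrite drop0 in r4 r5 rM.
have c_b := center_le.
have cE : R 4 + R 5 = c by rewrite r4 r5 addnC.
do 2 (exec; rewrite ?cE ?r0 ?r2; first lia).
move=> xb; apply: eventually_now => //; split; rewrite /=; read_upd;
  rewrite ?drop_size ?big_nil ?addn0 //.
by rewrite (ltn_trans _ n_gt2).
Qed.

(** For the tested value [z], the bit is 0 iff [z != 3] and [z - 5 = 0], inverted twice; subtracting
    the total excess clears it if symmetry fails. *)
Lemma verdict x :
  fits b x -> testing_inv 0 x ->
  eventually fair_program b 13
    (fun y => halted fair_program y /\ reg y 0 = fair_test s) x.
Proof.
case: x => l R M + [/= lE _ r0 r1 r2 r4 r8 r9 r10 _]; subst l.
rewrite drop0 in r8 r9 r10.
have h_n := count_size (fun v => v + v == c) s; rewrite -/n in h_n.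
do 3 exec; first lia.
do 3 exec; first lia.
do 2 (exec; rewrite ?r1); first lia.
do 2 exec; first lia.
do 3 exec; move=> xb; apply: eventually_now => //; split=> //=.
read_upd; rewrite r1 r8 r9 r10 /fair_test -/c.
set h := count _ s; set p := odd _.
have -> : all (fun v => count_mem v s <= count_mem (c - v) s) s =
    (\sum_(v <- s) (count_mem v s - count_mem (c - v) s) == 0).
  by rewrite sum_nat_seq_eq0; apply: eq_all.
set e := \sum_(_ <- _) _; move: h p e; clear; lia.
Qed.

Lemma fair_program_correct : exists t,
  [/\ t <= 31 * n.+1, halted fair_program (run fair_program t (init s)),
      forall t', t' <= t -> fits b (run fair_program t' (init s))
    & reg (run fair_program t (init s)) 0 = fair_test s].
Proof.
(* The phases take at most [4 + 11 * n + 2 + 20 * n + 13] steps. *)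
have [t [tC [t_halt t_test] t_fits]] := eventually_trans counting_start
  (fun x xb I1 => eventually_trans (eventually_loop counting_body xb I1)
  (fun x xb I2 => eventually_trans (testing_start xb I2)
  (fun x xb I3 => eventually_trans (eventually_loop testing_body xb I3) verdict))).
by exists t; split=> //; lia.
Qed.

End Correctness.

Theorem corollary7 :
  linear_time_decidable
    (fun s : seq nat => 2 <= (size s).-1)
    (fun s : seq nat =>
       has_fair_draw 2 (fun i : 'I_(size s) => nth 0 s i)).
Proof.
exists fair_program, 31, 2 => s s_size; have n_gt2 : 2 < size s by lia.
have [t [tC t_halt t_fits t_test]] := fair_program_correct n_gt2.
exists t; split=> // [/(has_fair_draw_test n_gt2) s_fair|no_draw].
  by rewrite t_test s_fair.
by rewrite t_test; case: (boolP (fair_test s)) => // /(fair_test_has_draw n_gt2).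
Qed.
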